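(* Let $n\ge 1$, and let $+$ and $\cdot$ denote componentwise addition and multiplication on $\mathbb{Z}^n$. Then $(\mathbb{Z}^n,2n,+,\cdot)$ is not a $DT$-$2n$-ring.
   Context: For $1\le t\le n$, two distinct points of $\mathbb{Z}^n$ are $k(t,n)$-adjacent if at most $t$ of their coordinates differ by $\pm1$ and all the other coordinates coincide; the adjacency is named by the number $k=k(t,n)=\sum_{i=1}^{t}2^i\binom{n}{i}$; in particular $2n=k(1,n)$. A digital image $(X,k)$ is a set $X\subset\mathbb{Z}^n$ with such an adjacency; for $x\in X$, $N_k(x,1)=\{y\in X: y \text{ is } k\text{-adjacent to } x\}\cup\{x\}$. A map $f:(X,k)\to(X,k)$ is $k$-continuous if $f(N_k(x,1))\subset N_{k}(f(x),1)$ for all $x\in X$. For $(X,k)$ with $k=k(t,n)$, put $k^\ast:=k(t,2n)$ (only a label). Distinct points $p=(x_1,x_2)$, $q$ of $X^2=X\times X$ are $G_{k^\ast}$-adjacent if $q\in (N_k(x_1,1)\times\{x_2\})\cup(\{x_1\}\times N_k(x_2,1))$; $N_{G_{k^\ast}}(p,1)$ is the set of points $G_{k^\ast}$-adjacent to $p$, together with $p$. A map $f:(X^2,G_{k^\ast})\to(X,k)$ is $(G_{k^\ast},k)$-continuous if $f(N_{G_{k^\ast}}(p,1))\subset N_k(f(p),1)$ for all $p\in X^2$. A $DT$-$k$-group $(X,k,\ast_1)$ is a digital image $(X,k)$ with a group structure $(X,\ast_1)$ such that $(x,y)\mapsto x\ast_1 y$ is $(G_{k^\ast},k)$-continuous and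 the inverse map $x\mapsto x^{-1}$ of $\ast_1$ is $k$-continuous; it is abelian if $(X,\ast_1)$ is. A $DT$-$k$-ring $(X,k,\ast_1,\star)$ is an abelian $DT$-$k$-group $(X,k,\ast_1)$ together with a ring structure $(X,\ast_1,\star)$ such that $(x,y)\mapsto x\star y$ is also $(G_{k^\ast},k)$-continuous from $(X^2,G_{k^\ast})$ to $(X,k)$. *)

(* Defs.v *)
From mathcomp Require Import all_boot all_order all_algebra.
From mathcomp Require Import boolp classical_sets functions.

Set Implicit Arguments.
Unset Strict Implicit.
Unset Printing Implicit Defensive.

Import Order.TTheory GRing.Theory Num.Theory.

Local Open Scope classical_set_scope.
Local Open Scope ring_scope.

(* Z^n is {ffun 'I_n -> int}, whose library operations +%R and *%R are the
   componentwise addition and multiplication. *)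
Notation "''Zn' n" := {ffun 'I_n -> int}
  (at level 8, n at level 2, format "''Zn'  n") : type_scope.

Definition adj_number (t n : nat) : nat :=
  (\sum_(1 <= i < t.+1) 2 ^ i * 'C(n, i))%N.

Lemma adj_number1 (n : nat) : adj_number 1 n = (2 * n)%N.
Proof. by rewrite /adj_number big_nat1 expn1 bin1. Qed.

Definition t_adjacent (n t : nat) (x y : 'Zn n) : Prop :=
  [/\ x <> y,
      forall i : 'I_n, x i = y i \/ `|x i - y i| = 1 &
      (#|[pred i : 'I_n | (`|x i - y i| == 1)%R]| <= t)%N].

Definition is_adj_number (n k : nat) : Prop :=
  exists t : nat, (1 <= t <= n)%N /\ k = adj_number t n.

(* The adjacency is addressed by its number k = k(t,n); t is determined by k
   because t |-> k(t,n) is increasing on 1 <= t <= n. *)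
Definition k_adjacent (n k : nat) (x y : 'Zn n) : Prop :=
  exists t : nat,
    [/\ (1 <= t <= n)%N, k = adj_number t n & t_adjacent t x y].

Section DigitalImage.
Variables (n k : nat) (X : set ('Zn n)).

Definition Nk (x : 'Zn n) : set ('Zn n) :=
  [set y | X y /\ k_adjacent k y x] `|` [set x].

Definition k_continuous (f : 'Zn n -> 'Zn n) : Prop :=
  set_fun X X f /\ forall x, X x -> f @` Nk x `<=` Nk (f x).

(* The label k* = k(t,2n) is a function of (k, n) and plays no role in the
   relation, so it is not an argument. *)
Definition G_adjacent (p q : 'Zn n * 'Zn n) : Prop :=
  p <> q /\ (Nk p.1 `*` [set p.2] `|` [set p.1] `*` Nk p.2) q.

Definition NG (p : 'Zn n * 'Zn n) : set ('Zn n * 'Zn n) :=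
  [set q | G_adjacent p q] `|` [set p].

Definition G_continuous (f : 'Zn n * 'Zn n -> 'Zn n) : Prop :=
  set_fun (X `*` X) X f /\
  forall p, (X `*` X) p -> f @` NG p `<=` Nk (f p).

(* Operations on X are maps on the ambient Z^n, constrained only on X. *)
Definition is_group_on (op : 'Zn n -> 'Zn n -> 'Zn n)
    (e : 'Zn n) (inv : 'Zn n -> 'Zn n) : Prop :=
  [/\ [/\ forall x y, X x -> X y -> X (op x y),
          X e &
          forall x, X x -> X (inv x)],
      forall x y z, X x -> X y -> X z -> op x (op y z) = op (op x y) z,
      forall x, X x -> op e x = x /\ op x e = x &
      forall x, X x -> op (inv x) x = e /\ op x (inv x) = e].

(* e and inv are determined on X by op, so quantifying them existentially
   adds no freedom. *)
Definition DT_group (op : 'Zn n -> 'Zn n -> 'Zn n) : Prop :=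
  is_adj_number n k /\
  exists (e : 'Zn n) (inv : 'Zn n -> 'Zn n),
    [/\ is_group_on op e inv,
        G_continuous (fun p => op p.1 p.2) &
        k_continuous inv].

Definition abelian_DT_group (op : 'Zn n -> 'Zn n -> 'Zn n) : Prop :=
  DT_group op /\ forall x y, X x -> X y -> op x y = op y x.

(* The ring axioms beyond the abelian group (X, add).  A multiplicative
   identity is not required, so a unital ring structure is a special case. *)
Definition is_ring_mul_on (add mul : 'Zn n -> 'Zn n -> 'Zn n) : Prop :=
  [/\ forall x y, X x -> X y -> X (mul x y),
      forall x y z, X x -> X y -> X z -> mul x (mul y z) = mul (mul x y) z,
      forall x y z, X x -> X y -> X z ->
        mul x (add y z) = add (mul x y) (mul x z) &
      forall x y z, X x -> X y -> X z ->
        mul (add x y) z = add (mul x z) (mul y z)].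

Definition DT_ring (add mul : 'Zn n -> 'Zn n -> 'Zn n) : Prop :=
  [/\ abelian_DT_group add,
      is_ring_mul_on add mul &
      G_continuous (fun p => mul p.1 p.2)].

End DigitalImage.

(* Main.v *)
Require Import Defs.
From mathcomp Require Import all_boot all_order all_algebra.
From mathcomp Require Import boolp classical_sets functions.

(* Multiplication by a fixed element with an entry 2 is not 2n-continuous:
   it sends the neighbours 0 and e_i to points whose i-th entries are 0 and 2. *)

Import GRing.Theory.

(** The obstruction lies in the product alone: moving the second factor from 0 to e_i is a step of
    G-adjacency, yet it shifts coordinate [i] of the product by 2, while by [Nk_coord] neighbours
    differ by at most 1 in each coordinate. *)

Definition unit_vector {n : nat} (i : 'I_n) : {ffun 'I_n -> int} :=
  [ffun j => (j == i)%:R%R].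

Lemma unit_vector_neq0 {n : nat} (i : 'I_n) : unit_vector i <> 0%R.
Proof. by move/ffunP/(_ i); rewrite !ffunE eqxx. Qed.

Lemma unit_vector_adjacent0 {n : nat} (i : 'I_n) :
  k_adjacent (2 * n) (unit_vector i) 0%R.
Proof.
exists 1%N; rewrite adj_number1; split=> //.
  (* The index [i] itself forces 1 <= n. *)
  by rewrite /= (leq_ltn_trans _ (ltn_ord i)).
split; first exact: unit_vector_neq0.
- by move=> j; rewrite !ffunE; case: eqP => _; [right | left].
(* Only coordinate [i] can change, which gives the bound t = 1. *)
- rewrite -(card1 i); apply/subset_leq_card/fintype.subsetP => j.
  by rewrite !inE !ffunE subr0; case: (j == i).
Qed.

Lemma Nk_coord {n k : nat} {X : set {ffun 'I_n -> int}}
    {x y : {ffun 'I_n -> int}} (i : 'I_n) :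
  Nk k X x y -> y i = x i \/ `|y i - x i|%R = 1%R.
Proof. by case=> [[_ [t [_ _ [_ yx _]]]]|->]; [exact: yx | left]. Qed.

Lemma mul_not_G_continuous {n : nat} (i : 'I_n) :
  ~ G_continuous (2 * n) (@setT {ffun 'I_n -> int}) (fun p => p.1 * p.2)%R.
Proof.
case=> _ cont; pose two : {ffun 'I_n -> int} := [ffun=> 2%R].
have near : NG (2 * n) setT (two, 0%R) (two, unit_vector i).
  left; split; first by case=> /esym; exact: unit_vector_neq0.
  by right; split=> //=; left; split=> //; exact: unit_vector_adjacent0.
have := cont (two, 0%R) (conj I I) _ (ex_intro2 _ _ _ near erefl).
(* At [i] the products are 2 and 0: neither equal nor at distance 1. *)
by move/(Nk_coord i); rewrite !ffunE eqxx => -[].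
Qed.

Theorem mainTheorem3 (n : nat) (hn : (1 <= n)%N) :
  ~ DT_ring (2 * n)%N (@setT {ffun 'I_n -> int}) +%R *%R.
Proof. by case=> _ _; exact: mul_not_G_continuous (Ordinal hn). Qed.
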